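(* Let $\mathbf{a},\mathbf{b}\in\mathbb{R}^n_{>0}$. The identity matrix $\mathbb{I}\in\mathrm{Sp}(2n)$ is a local minimum of the function $\mathrm{Sp}(2n)\to\mathbb{R}$ defined by $P\mapsto\mathrm{M}(PE(\mathbf{a},\mathbf{b}))$ if and only if $\mathbf{a}=\mathbf{b}$. Moreover, $\mathbb{I}$ is an isolated local minimum of the function $P\mapsto\mathrm{M}(PE(\mathbf{a},\mathbf{a}))$ on $\mathrm{Sp}(2n)$ for any $\mathbf{a}\in\mathbb{R}^n_{>0}$.
   Context: For $\mathbf{a}=(a_1,\dots,a_n)$ and $\mathbf{b}=(b_1,\dots,b_n)$ in $\mathbb{R}^n_{>0}$, $E(\mathbf{a},\mathbf{b})=\{(x_1,\dots,x_n,y_1,\dots,y_n)\in\mathbb{R}^{2n}: \sum_{i=1}^n(x_i^2/a_i^2+y_i^2/b_i^2)\le 1\}$. For a bounded subset $X\subset\mathbb{R}^{d}$, the support function is $h_X(u)=\sup_{k\in X}\langle k,u\rangle$ and the mean width is $\mathrm{M}(X)=\int_{S^{d-1}}(h_X(u)+h_X(-u))\,d\sigma$, where $\sigma$ is the rotationally invariant probability measure on the unit sphere $S^{d-1}\subset\mathbb{R}^d$. $\mathrm{Sp}(2n)$ is the group of real symplectic $2n\times 2n$ matrices (for the standard symplectic form pairing $x_i$ with $y_i$), and $PE(\mathbf{a},\mathbf{b})$ is the image of the ellipsoid under $P$.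
   Formalization: M(UPE)=M(PE) for every U in U(n)=Sp(2n)∩O(2n), so I is never literally an isolated local minimum; ''isolated'' is read modulo U(n): I is a local minimum and M(PE(a,a)) > M(E(a,a)) for every symplectic P near I outside U(n). *)

(* Defs.v *)
From mathcomp Require Import all_boot all_order all_algebra.
From mathcomp Require Import all_classical all_reals all_analysis.

Set Implicit Arguments.
Unset Strict Implicit.
Unset Printing Implicit Defensive.

Import Order.TTheory GRing.Theory Num.Theory.
Import numFieldNormedType.Exports.

Local Open Scope classical_set_scope.
Local Open Scope ring_scope.

Definition dot (R : realType) (d : nat) (u v : 'cV[R]_d) : R :=
  \sum_(i < d) u i 0 * v i 0.

Definition sphere (R : realType) (d : nat) : set 'cV[R]_d :=
  [set u | dot u u = 1].

Definition rotation (R : realType) (d : nat) : set 'M[R]_d :=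
  [set Q | Q^T *m Q = 1%:M /\ \det Q = 1].

Definition borel (R : realType) (d : nat) :=
  g_sigma_algebraType (@open 'cV[R]_d).

(* The measure on the sphere S^(d-1) is represented by its extension by zero
   to the Borel sets of R^d.  For d >= 2 exactly one probability measure
   satisfies this predicate. *)
Definition rotation_invariant_on_sphere (R : realType) (d : nat)
    (sigma : probability (borel R d) R) : Prop :=
  sigma (@sphere R d) = 1%E /\
  forall (Q : 'M[R]_d), rotation Q ->
    forall A : set (borel R d), measurable A ->
      sigma ((mulmx Q : 'cV[R]_d -> 'cV[R]_d) @^-1` A) = sigma A.

Definition support_function (R : realType) (d : nat) (X : set 'cV[R]_d)
    (u : 'cV[R]_d) : R :=
  sup [set dot k u | k in X].

Definition mean_width (R : realType) (d : nat)
    (sigma : probability (borel R d) R) (X : set 'cV[R]_d) : R :=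
  \int[sigma]_(u in @sphere R d)
    (support_function X u + support_function X (- u)).

(* A point (x, y) of R^(2n) is the column [col_mx x y]. *)
Definition ellipsoid (R : realType) (n : nat) (a b : 'rV[R]_n) :
    set 'cV[R]_(n + n) :=
  [set z | \sum_(i < n) ((usubmx z i 0) ^+ 2 / (a 0 i) ^+ 2
                         + (dsubmx z i 0) ^+ 2 / (b 0 i) ^+ 2) <= 1].

Definition standard_J (R : realType) (n : nat) : 'M[R]_(n + n) :=
  block_mx 0 1%:M (- 1%:M) 0.

Definition Sp (R : realType) (n : nat) : set 'M[R]_(n + n) :=
  [set P | P^T *m standard_J R n *m P = standard_J R n].

(* The unitary group U(n), as the group of orthogonal symplectic matrices. *)
Definition Un (R : realType) (n : nat) : set 'M[R]_(n + n) :=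
  @Sp R n `&` [set P | P^T *m P = 1%:M].

Definition same_Un_orbit (R : realType) (n : nat) (P Q : 'M[R]_(n + n)) : Prop :=
  exists2 U, @Un R n U & P = U *m Q.

Definition local_min_on (R : realType) (T : topologicalType) (G : set T)
    (f : T -> R) (x : T) : Prop :=
  \forall y \near within G (nbhs x), f x <= f y.

(* Isolation is relative to an equivalence relation [r].  The mean width of
   [P E] only depends on the orbit of [P] under left multiplication by U(n)
   (rotating a body does not change its mean width), a positive-dimensional
   family through each [P], so for that function a minimum can be isolated
   only up to [same_Un_orbit]; with [r := eq] one gets strict local minima. *)
Definition isolated_local_min_on (R : realType) (T : topologicalType)
    (G : set T) (r : T -> T -> Prop) (f : T -> R) (x : T) : Prop :=
  local_min_on G f x /\
  \forall y \near within G (nbhs x), ~ r y x -> f x < f y.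

(* Main.v *)
Require Import Defs.
From HB Require Import structures.
From mathcomp Require Import all_boot all_order all_algebra perm.
From mathcomp Require Import all_classical all_reals all_analysis.
From mathcomp Require Import measurable_realfun ring lra.
Import Order.TTheory GRing.Theory Num.Theory.
Import numFieldNormedType.Exports.
Local Open Scope classical_set_scope.
Local Open Scope ring_scope.

Set Implicit Arguments.
Unset Strict Implicit.
Unset Printing Implicit Defensive.

(** Write [D] for the diagonal matrix of semi-axes, so that the ellipsoid is
    the image under [D] of the unit ball, and [mean_norm M] for the mean over
    the sphere of the Euclidean norm of [M *m u].  The support function of
    [P E] at [u] is the norm of [D P^T u], so the mean width of [P E] is twice
    [mean_norm (D *m P^T)] (lemma [mean_width_ellipsoid]), and everything
    reduces to properties of [mean_norm].

    It is a norm on matrices, it is strictly monotone in the Gram matrix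
    [M^T M] ([mean_norm_lt]), and, which is the key point, it is invariant
    under transposition ([mean_norm_trmx]).  Indeed the norm of [v] is
    proportional to the mean over [w] of the absolute value of [dot v w],
    so [mean_norm M] is proportional to the double mean of the absolute value
    of [dot (M u) w], in which exchanging [u] and [w], as Fubini allows,
    amounts to transposing [M].  Hence [mean_norm] is invariant under
    orthogonal matrices on both sides.

    If [a = b], then [D] commutes with the complex structure [J].  Put
    [Q := P^T] and let [A := (Q - J Q J) / 2], [B := (Q + J Q J) / 2] be its
    complex-linear and antilinear parts; [Q] being symplectic,
    [A A^T = 1 + B B^T].  Since [D J Q J = J D Q J] has the same mean norm as
    [D Q], averaging gives
      [mean_norm (D Q) >= mean_norm (D A) = mean_norm (A^T D)],
    and [(A^T D)^T (A^T D) = D^2 + (B^T D)^T (B^T D)] shows that the latter is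
    at least [mean_norm D], strictly unless [B = 0], that is, unless [P] is
    orthogonal.  So the identity is even a global minimum, attained exactly
    on the unitary group.

    If [a i != b i] for some [i], call [al > be] these two semi-axes.  The
    symplectic matrix that multiplies the longer one by [s < 1] and the
    shorter one by [1 / s], with [s] close to 1, yields semi-axes that are at
    most those of a convex combination of [D] and of [D] with the two
    semi-axes exchanged, one of them being strictly smaller, because
    [al s + be / s < al + be].  As [D] and its exchanged version have the same
    mean norm, convexity shows that the mean width strictly decreases
    ([mean_norm_squeeze]), and the identity is not a local minimum. *)

(** * The Euclidean norm *)

Section EuclideanNorm.
Context {R : realType} {d : nat}.
Implicit Types (u v w : 'cV[R]_d) (c : R).

Lemma dotC u v : dot u v = dot v u.
Proof. by apply: eq_bigr => i _; rewrite mulrC. Qed.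

Lemma dotDl u v w : dot (u + v) w = dot u w + dot v w.
Proof. by rewrite -big_split; apply: eq_bigr => i _; rewrite mxE mulrDl. Qed.

Lemma dotZl c u v : dot (c *: u) v = c * dot u v.
Proof. by rewrite mulr_sumr; apply: eq_bigr => i _; rewrite mxE mulrA. Qed.

Lemma dotNl u v : dot (- u) v = - dot u v.
Proof. by rewrite -scaleN1r dotZl mulN1r. Qed.

Lemma dotDr u v w : dot u (v + w) = dot u v + dot u w.
Proof. by rewrite dotC dotDl !(dotC u). Qed.

Lemma dotZr c u v : dot u (c *: v) = c * dot u v.
Proof. by rewrite dotC dotZl dotC. Qed.

Lemma dotNr u v : dot u (- v) = - dot u v.
Proof. by rewrite dotC dotNl dotC. Qed.

Definition dotE := (dotDl, dotDr, dotZl, dotZr, dotNl, dotNr).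

Lemma dot_mulmxE u v : dot u v = (u^T *m v) 0 0.
Proof. by rewrite mxE; apply: eq_bigr => i _; rewrite mxE. Qed.

Lemma dot_ge0 u : 0 <= dot u u.
Proof. by apply: sumr_ge0 => i _; rewrite -expr2 sqr_ge0. Qed.

Lemma dot_eq0 u : (dot u u == 0) = (u == 0).
Proof.
apply/idP/eqP => [|->]; last first.
  by rewrite /dot big1 // => i _; rewrite mxE mul0r.
rewrite psumr_eq0 => [/allP u0|i _]; last by rewrite -expr2 sqr_ge0.
apply/colP => i; rewrite mxE; apply/eqP.
by have := u0 i; rewrite mem_index_enum mulf_eq0 orbb => /(_ isT).
Qed.

(** The nonnegativity of the squared norm of [dot v v *: u - dot u v *: v]. *)
Lemma cauchy_schwarz u v : dot u v ^+ 2 <= dot u u * dot v v.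
Proof.
have [v0|v0] := eqVneq (dot v v) 0.
  have /eqP -> : v == 0 by rewrite -dot_eq0 v0.
  by rewrite -(scale0r (0 : 'cV[R]_d)) !dotE !mul0r expr0n mulr0.
have v_gt0 : 0 < dot v v by rewrite lt_def v0 dot_ge0.
have := dot_ge0 (dot v v *: u - dot u v *: v).
rewrite !dotE (dotC v u).
rewrite [X in 0 <= X -> _](_ : _ =
  dot v v * (dot u u * dot v v - dot u v ^+ 2)); last by ring.
by rewrite pmulr_rge0 // subr_ge0.
Qed.

Definition enorm u : R := Num.sqrt (dot u u).

Lemma enorm_ge0 u : 0 <= enorm u.
Proof. exact: sqrtr_ge0. Qed.

Lemma sqr_enorm u : enorm u ^+ 2 = dot u u.
Proof. by rewrite sqr_sqrtr // dot_ge0. Qed.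

Lemma enorm_eq0 u : (enorm u == 0) = (u == 0).
Proof. by rewrite -dot_eq0 -sqr_enorm sqrf_eq0. Qed.

Lemma enormZ c u : enorm (c *: u) = `|c| * enorm u.
Proof.
by rewrite /enorm dotZl dotZr mulrA -expr2 sqrtrM ?sqr_ge0 // sqrtr_sqr.
Qed.

Lemma ler_abs_dot u v : `|dot u v| <= enorm u * enorm v.
Proof.
rewrite -sqrtrM ?dot_ge0 // -sqrtr_sqr ler_sqrt ?cauchy_schwarz //.
by rewrite mulr_ge0 ?dot_ge0.
Qed.

Lemma enormD u v : enorm (u + v) <= enorm u + enorm v.
Proof.
rewrite -(@ler_pXn2r _ 2) ?nnegrE ?addr_ge0 ?enorm_ge0 //.
rewrite sqrrD !sqr_enorm !dotE (dotC v u).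
have := le_trans (ler_norm _) (ler_abs_dot u v); lra.
Qed.

End EuclideanNorm.

(** * Rotations acting transitively on spheres *)

Section Matrices.
Context {R : realType} {d : nat}.
Implicit Types (M Q : 'M[R]_d) (u v : 'cV[R]_d).

Lemma dot_mulmxl M u v : dot (M *m u) v = dot u (M^T *m v).
Proof. by rewrite !dot_mulmxE trmx_mul mulmxA. Qed.

Lemma dot_gram M u : dot (M *m u) (M *m u) = (u^T *m (M^T *m M) *m u) 0 0.
Proof. by rewrite dot_mulmxE trmx_mul !mulmxA. Qed.

Lemma enorm_orthogonal Q u : Q^T *m Q = 1%:M -> enorm (Q *m u) = enorm u.
Proof. by move=> Qo; rewrite /enorm dot_gram Qo mulmx1 -dot_mulmxE. Qed.

Lemma rotation_trmx Q : rotation Q -> rotation Q^T.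
Proof.
by move=> [Qo Qd]; split; rewrite ?det_tr // trmxK; apply: mulmx1C.
Qed.

(** Both factorisations of the bordered matrix [[1, v], [u, 1]] into
    triangular blocks compute its determinant. *)
Lemma det_rank1_update u (v : 'rV[R]_d) :
  \det (1%:M - u *m v) = 1 - (v *m u) 0 0.
Proof.
pose B := block_mx (1%:M : 'M[R]_1) v u 1%:M.
pose L := block_mx (1%:M : 'M[R]_1) 0 (- u) 1%:M.
have dL : \det L = 1 by rewrite det_lblock !det1 mulr1.
have BL : B *m L = block_mx (1%:M - v *m u) v 0 1%:M.
  by rewrite mulmx_block !mulmx1 !mul1mx !mulmx0 mulmxN !add0r subrr.
have LB : L *m B = block_mx 1%:M v 0 (1%:M - u *m v).
  by rewrite mulmx_block !mulmx1 !mul1mx !mul0mx !addr0 mulNmx addNr addrC.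
have := det_mulmx L B; rewrite mulrC -det_mulmx LB BL !det_ublock !det1.
by rewrite mul1r mulr1 => ->; rewrite det_mx11 mxE; congr (_ + _); rewrite mxE.
Qed.

Definition reflection u : 'M[R]_d := 1%:M - (2 / dot u u) *: (u *m u^T).

Lemma reflectionE u v :
  reflection u *m v = v - (2 * dot u v / dot u u) *: u.
Proof.
rewrite mulmxBl mul1mx -scalemxAl -mulmxA.
rewrite [u^T *m v](mx11_scalar) -dot_mulmxE mul_mx_scalar scalerA.
by congr (_ - _ *: _); ring.
Qed.

Lemma reflection_sym u : (reflection u)^T = reflection u.
Proof. by rewrite /reflection linearB linearZ /= trmx_mul trmxK trmx1. Qed.

Lemma reflection_normal u : u != 0 -> reflection u *m u = - u.
Proof.
rewrite -dot_eq0 => u0; rewrite reflectionE -mulrA divff // mulr1.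
by rewrite scaler_nat mulr2n opprD addrA subrr add0r.
Qed.

Lemma reflectionK u : u != 0 -> reflection u *m reflection u = 1%:M.
Proof.
move=> u0; rewrite {2}/reflection mulmxBr mulmx1 -scalemxAr mulmxA.
by rewrite reflection_normal // mulNmx scalerN opprK /reflection subrK.
Qed.

Lemma det_reflection u : u != 0 -> \det (reflection u) = -1.
Proof.
rewrite -dot_eq0 => u0; rewrite /reflection scalemxAl det_rank1_update.
by rewrite -scalemxAr mxE -dot_mulmxE divfK //; ring.
Qed.

(** The reflection in the hyperplane orthogonal to [u] sends [u] to [- u], and
    the one in the hyperplane orthogonal to [u + v] sends [- u] to [v]; the
    product of two reflections has determinant 1. *)
Lemma rotation_between u v : dot u u = dot v v -> u + v != 0 ->
  exists2 Q, rotation Q & Q *m u = v.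
Proof.
move=> uv uv0.
have u0 : u != 0.
  apply: contraNneq uv0 => u0; move: uv.
  by rewrite u0 add0r -dot_eq0 => <-; rewrite dot_eq0.
exists (reflection (u + v) *m reflection u).
  split; last by rewrite det_mulmx !det_reflection // mulrNN mulr1.
  rewrite trmx_mul !reflection_sym -mulmxA (mulmxA (reflection (u + v))).
  by rewrite reflectionK // mul1mx reflectionK.
rewrite -mulmxA reflection_normal // reflectionE.
move: uv0; rewrite -(dot_eq0 (u + v)) => uv0.
have -> : 2 * dot (u + v) (- u) / dot (u + v) (u + v) = - 1.
  apply: (mulIf uv0); rewrite divfK // !dotE (dotC v u) -uv; ring.
by rewrite scaleN1r opprK addKr.
Qed.

End Matrices.

(** * Borel measurability on Euclidean space *)

Section Measurability.
Context {R : realType} {d : nat}.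

Lemma open_borel (A : set 'cV[R]_d) :
  open A -> measurable (A : set (borel R d)).
Proof. exact: sub_sigma_algebra. Qed.

Lemma continuous_measurable_borel (f : 'cV[R]_d -> R) :
  continuous f -> measurable_fun [set: borel R d] f.
Proof.
move=> /continuousP cf.
apply: (measurability _ (RGenOInfty.measurableE R)) => _ [B [a ->] <-].
rewrite setTI; apply: open_borel; apply: cf; exact: rray_open.
Qed.

Lemma measurable_coord i :
  measurable_fun [set: borel R d] (fun u : 'cV[R]_d => u i 0).
Proof. by apply: continuous_measurable_borel; exact: coord_continuous. Qed.

Lemma measurable_dot (v : 'cV[R]_d) :
  measurable_fun [set: borel R d] (fun u : 'cV[R]_d => dot v u).
Proof.
apply: measurable_sum => i; apply: measurable_funM => //.
exact: measurable_coord.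
Qed.

Lemma measurable_mulmx m (M : 'M[R]_(m, d)) :
  measurable_fun [set: borel R d] (mulmx M : borel R d -> borel R m).
Proof.
apply: (measurability (@open 'cV[R]_m : set (set (borel R m)))) => //.
move=> _ [B oB <-].
rewrite setTI; apply: open_borel.
suff : continuous (mulmx M : 'cV[R]_d -> 'cV[R]_m).
  by move=> /continuousP; apply.
move=> u A [P Pnbhs PA].
have cM i : {for u, continuous (fun w : 'cV[R]_d => (M *m w) i 0)}.
  have -> : (fun w : 'cV[R]_d => (M *m w) i 0) =
      (fun w : 'cV[R]_d => \sum_k M i k * w k 0).
    by apply/funext => w; rewrite mxE.
  apply: (@cvg_big _ _ +%R 0 xpredT _ _ (nbhs u)) => [|k _].
    exact: add_continuous.
  apply: cvgM; first exact: cvg_cst.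
  exact: coord_continuous.
have : \forall w \near nbhs u, forall i, P i 0 ((M *m w) i 0).
  by apply: filter_forall => i; apply: (cM i); exact: Pnbhs.
by apply: filterS => w Pw; apply: PA => i j; rewrite ord1.
Qed.

Lemma measurable_enorm : measurable_fun [set: borel R d] (@enorm R d).
Proof.
have msqrt : measurable_fun [set: R] (Num.sqrt : R -> R).
  apply: continuous_measurable_fun; exact: sqrt_continuous.
apply: (measurableT_comp msqrt).
apply: measurable_sum => i.
by apply: measurable_funM; exact: measurable_coord.
Qed.

Lemma measurable_sphere : measurable (@sphere R d : set (borel R d)).
Proof.
have -> : @sphere R d = (@enorm R d) @^-1` [set 1].
  apply/seteqP; split=> u; rewrite /sphere /= /enorm.
    by move=> ->; rewrite sqrtr1.
  by move=> u1; rewrite -sqr_enorm /enorm u1 expr1n.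
by rewrite -[X in measurable X]setTI; apply: measurable_enorm.
Qed.

End Measurability.

(** * Integrals over the sphere *)

Section SphericalIntegrals.
Context {R : realType} {d : nat} (sigma : probability (borel R d) R).
Hypothesis hsigma : rotation_invariant_on_sphere sigma.
Local Notation S := (@sphere R d : set (borel R d)).
Implicit Types (f : 'cV[R]_d -> R) (u v w : 'cV[R]_d) (M Q : 'M[R]_d).

Lemma sphere_enorm u : S u -> enorm u = 1.
Proof. by rewrite /sphere /enorm /= => ->; rewrite sqrtr1. Qed.

Lemma integrable_sphere f (K : R) : measurable_fun [set: borel R d] f ->
  (forall u, S u -> `|f u| <= K) -> sigma.-integrable S (EFin \o f).
Proof.
move=> mf fK; apply: measurable_bounded_integrable.
- exact: measurable_sphere.
- by rewrite [X in (X < _)%E](_ : _ = 1%E) ?ltry //; exact: hsigma.1.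
- exact: measurable_funTS.
- exists K; split; first exact: num_real.
  by move=> x Kx u /fK /le_trans; apply; exact: ltW.
Qed.

Lemma integrable_abs_dot v :
  sigma.-integrable S (EFin \o (fun u => `|dot v u|)).
Proof.
apply: (@integrable_sphere _ (enorm v)) => [|u Su].
  by apply: measurableT_comp => //; exact: measurable_dot.
by rewrite normr_id (le_trans (ler_abs_dot _ _)) // (sphere_enorm Su) mulr1.
Qed.

(** The complement of the sphere is negligible, which lets Tonelli's theorem
    on the whole space be applied to integrals over the sphere. *)
Lemma integral_sphereT f : measurable_fun [set: borel R d] f ->
  (forall u, 0 <= f u) ->
  (\int[sigma]_u (f u)%:E = \int[sigma]_(u in S) (f u)%:E)%E.
Proof.
move=> mf f0; rewrite (@ge0_negligible_integral _ _ _ _ _ (~` S)) //.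
- by rewrite setTD setCK.
- by apply: measurableC; exact: measurable_sphere.
- exact/measurable_EFinP.
- by move=> u _; rewrite lee_fin.
- have := probability_setC sigma (measurable_sphere (R := R) (d := d)).
  move=> /= ->; rewrite [X in (1 - X)%E](_ : _ = 1%E) ?subee //.
  exact: hsigma.1.
Qed.

Lemma integral_rotation Q f : rotation Q -> measurable_fun [set: borel R d] f ->
  (forall u, 0 <= f u) ->
  \int[sigma]_(u in S) f (Q *m u) = \int[sigma]_(u in S) f u.
Proof.
move=> rQ mf f0; congr fine.
pose phi : borel R d -> borel R d := mulmx Q.
pose phi_mixin := isMeasurableFun.Build _ _ _ _ phi (measurable_mulmx Q).
pose mphi : {mfun borel R d >-> borel R d} := HB.pack phi phi_mixin.
transitivity (\int[pushforward sigma mphi]_(u in S) (f u)%:E)%E.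
  rewrite (ge0_integral_pushforward (measurable_mulmx Q)).
  - congr (integral _ _ _); apply/seteqP; split=> u; rewrite /sphere /=;
    by rewrite dot_gram rQ.1 mulmx1 dot_mulmxE.
  - exact: measurable_sphere.
  - by apply/measurable_EFinP; exact: measurable_funTS.
  - by move=> u _; rewrite lee_fin.
apply: eq_measure_integral => A mA _.
exact: hsigma.2.
Qed.


Lemma sphere_nonempty : exists u, S u.
Proof.
apply: contrapT => /forallNP S0.
have : (sigma S = 0)%E by rewrite (_ : S = set0) ?measure0 // -subset0.
by rewrite [X in X = _](_ : _ = 1%E) ?hsigma.1 //; apply/eqP; rewrite onee_eq0.
Qed.

Definition mean_abs_dot v := \int[sigma]_(w in S) `|dot v w|.

Lemma mean_abs_dot_rotation Q v : rotation Q ->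
  mean_abs_dot (Q *m v) = mean_abs_dot v.
Proof.
move=> rQ; rewrite /mean_abs_dot.
under eq_Rintegral do rewrite dot_mulmxl.
apply: (@integral_rotation Q^T (fun w => `|dot v w|)) => //.
- exact: rotation_trmx.
- by apply: measurableT_comp => //; exact: measurable_dot.
Qed.

Lemma mean_abs_dotZ c v : mean_abs_dot (c *: v) = `|c| * mean_abs_dot v.
Proof.
rewrite /mean_abs_dot -RintegralZl; last 2 first.
- exact: measurable_sphere.
- exact: integrable_abs_dot.
by apply: eq_Rintegral => w _; rewrite dotZl normrM.
Qed.

Lemma mean_abs_dot_eq_enorm u v : enorm u = enorm v ->
  mean_abs_dot u = mean_abs_dot v.
Proof.
move=> uv; have [/eqP|uv0] := eqVneq (u + v) 0.
  (* The construction of [rotation_between] excludes antipodal vectors;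
     for these the integrands agree pointwise. *)
  by rewrite addr_eq0 => /eqP ->; rewrite -scaleN1r mean_abs_dotZ normrN1 mul1r.
have [|Q rQ <-] := @rotation_between R d u v _ uv0.
  by rewrite -!sqr_enorm uv.
by rewrite mean_abs_dot_rotation.
Qed.

(** Integrating [1 = \sum_k w_k ^+ 2 <= \sum_k `|w_k|] over the sphere; this
    keeps [mean_abs_dot] from vanishing identically. *)
Lemma sum_mean_abs_delta : 1 <= \sum_(k < d) mean_abs_dot (delta_mx k 0).
Proof.
have mS := @measurable_sphere R d.
pose D k : 'cV[R]_d := delta_mx k 0.
have dotD k w : dot (D k) w = w k 0.
  rewrite /dot (bigD1 k) //= big1 => [|i /negPf ik]; rewrite !mxE ?ik ?mul0r //.
  by rewrite !eqxx mul1r addr0.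
have iD k := integrable_abs_dot (D k).
have /= iDsum : sigma.-integrable S
    (EFin \o (fun w => \sum_(k < d) `|dot (D k) w|)).
  apply: (@integrable_sphere _ (\sum_(k < d) enorm (D k))) => [|u Su].
    apply: measurable_sum => k; apply: measurableT_comp => //.
    exact: measurable_dot.
  rewrite ger0_norm; last by apply: sumr_ge0.
  apply: ler_sum => k _; rewrite (le_trans (ler_abs_dot _ _)) //.
  by rewrite (sphere_enorm Su) mulr1.
have -> : \sum_(k < d) mean_abs_dot (D k) =
    \int[sigma]_(w in S) \sum_(k < d) `|dot (D k) w|.
  apply: EFin_inj; rewrite -sumEFin.
  rewrite fineK; last exact: integrable_fin_num.
  under [RHS]eq_integral do rewrite -sumEFin.
  rewrite ge0_integral_sum //.
  - apply: eq_bigr => k _; rewrite /mean_abs_dot fineK //.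
    exact: integrable_fin_num (iD k).
  - move=> k; exact: measurable_int (iD k).
have -> : 1 = \int[sigma]_(w in S) (1 : R).
  rewrite Rintegral_cst // mul1r; have := hsigma.1; by move=> /= ->.
apply: le_Rintegral => //.
  apply: (@integrable_sphere (fun=> 1) 1) => //.
  by move=> u _; rewrite normr1.
move=> u Su; rewrite -[leLHS](Su : dot u u = 1); apply: ler_sum => k _.
rewrite dotD -expr2 -real_normK ?num_real // expr2 ler_piMr //.
rewrite -dotD (le_trans (ler_abs_dot _ _)) // (sphere_enorm Su) mulr1.
by rewrite /enorm dotD mxE !eqxx sqrtr1.
Qed.
End SphericalIntegrals.

(** * The mean norm of a matrix *)

Section MeanNorm.
Context {R : realType} {d : nat} (sigma : probability (borel R d) R).
Hypothesis hsigma : rotation_invariant_on_sphere sigma.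
Local Notation S := (@sphere R d : set (borel R d)).
Implicit Types (u v w : 'cV[R]_d) (M C Q : 'M[R]_d).

(** [mean_abs_dot] is homogeneous and depends on the norm only, so it is
    determined by its value on one unit vector. *)
Lemma mean_abs_dot_propto :
  exists2 k : R, 0 < k & forall v, mean_abs_dot sigma v = k * enorm v.
Proof.
have [e Se] := sphere_nonempty hsigma.
pose k := mean_abs_dot sigma e.
have kE v : mean_abs_dot sigma v = k * enorm v.
  rewrite (mean_abs_dot_eq_enorm hsigma (v := enorm v *: e)); last first.
    by rewrite enormZ (sphere_enorm Se) mulr1 ger0_norm // enorm_ge0.
  by rewrite mean_abs_dotZ // ger0_norm ?enorm_ge0 // mulrC.
exists k => //.
rewrite lt_def Rintegral_ge0 ?andbT //.
apply: contraTN (sum_mean_abs_delta hsigma) => /eqP k0.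
by rewrite big1 ?ler10 // => i _; rewrite kE k0 mul0r.
Qed.

Definition mean_norm M : R := \int[sigma]_(u in S) enorm (M *m u).

Lemma measurable_enorm_mulmx M :
  measurable_fun [set: borel R d] (fun u : 'cV[R]_d => enorm (M *m u)).
Proof.
apply: (measurableT_comp (T2 := borel R d) measurable_enorm).
exact: measurable_mulmx.
Qed.

Lemma enorm_mulmx_bounded M : exists K, forall u, enorm (M *m u) <= K * enorm u.
Proof.
pose row_norm i := enorm (row i M)^T.
exists (\sum_i row_norm i) => u.
have rowE i : (M *m u) i 0 = dot (row i M)^T u.
  by rewrite mxE; apply: eq_bigr => j _; rewrite !mxE.
have sum_ge0 : 0 <= \sum_i row_norm i.
  by apply: sumr_ge0 => i _; exact: enorm_ge0.
rewrite -(@ler_pXn2r _ 2) ?nnegrE ?mulr_ge0 ?enorm_ge0 //.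
rewrite sqr_enorm exprMn /dot.
apply: (@le_trans _ _ (\sum_i (row_norm i * enorm u) ^+ 2)).
  apply: ler_sum => i _; rewrite rowE -expr2 -real_normK ?num_real //.
  by rewrite ler_pXn2r ?nnegrE ?mulr_ge0 ?enorm_ge0 // ler_abs_dot.
under eq_bigr do rewrite exprMn.
rewrite -mulr_suml ler_wpM2r ?sqr_ge0 // expr2 mulr_suml.
apply: ler_sum => i _; rewrite expr2 ler_wpM2l ?enorm_ge0 //.
by rewrite (bigD1 i) //= lerDl sumr_ge0 // => j _; exact: enorm_ge0.
Qed.

Lemma integrable_enorm_mulmx M :
  sigma.-integrable S (EFin \o (fun u => enorm (M *m u))).
Proof.
have [K MK] := enorm_mulmx_bounded M.
apply: (integrable_sphere hsigma (K := K)) => [|u Su].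
  exact: measurable_enorm_mulmx.
by rewrite ger0_norm ?enorm_ge0 // (le_trans (MK _)) // (sphere_enorm Su) mulr1.
Qed.

(** Up to a constant, [enorm v] is the mean over [w] of [`|dot v w|], so
    [mean_norm M] is the double mean of [`|dot (M *m u) w|], in which
    transposing [M] amounts to exchanging [u] and [w]. *)
Lemma mean_norm_trmx M : mean_norm M^T = mean_norm M.
Proof.
have [k k_gt0 kE] := mean_abs_dot_propto.
have mS := @measurable_sphere R d.
have innerE v : (\int[sigma]_w `|dot v w|%:E = (k * enorm v)%:E)%E.
  rewrite (integral_sphereT hsigma) //; last first.
    by apply: measurableT_comp => //; exact: measurable_dot.
  rewrite -kE /mean_abs_dot fineK //.
  exact: integrable_fin_num (integrable_abs_dot hsigma v).
have outerE N : (\int[sigma]_u \int[sigma]_w `|dot (N *m u) w|%:E =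
    (k * mean_norm N)%:E)%E.
  under eq_integral do rewrite innerE.
  rewrite (integral_sphereT hsigma (f := fun u => k * enorm (N *m u))).
  - rewrite -RintegralZl // ?fineK //.
      apply: integrable_fin_num => //.
      exact: integrableZl (integrable_enorm_mulmx N).
    exact: integrable_enorm_mulmx.
  - by apply: measurable_funM => //; exact: measurable_enorm_mulmx.
  - by move=> u; rewrite mulr_ge0 ?enorm_ge0 // ltW.
apply: (mulfI (lt0r_neq0 k_gt0)); apply: EFin_inj; rewrite -!outerE.
transitivity (\int[sigma]_u \int[sigma]_w `|dot (M *m w) u|%:E)%E.
  apply: eq_integral => u _; apply: eq_integral => w _.
  by rewrite dot_mulmxl trmxK dotC.
apply: (fubini_tonelli (m1 := sigma) (m2 := sigma)
  (fun uw : borel R d * borel R d => `|dot (M *m uw.2) uw.1|%:E)) => //.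
have mcoord i := @measurable_coord R d i.
apply/measurable_EFinP; apply: measurableT_comp => //.
apply: measurable_sum => i; apply: measurable_funM.
  apply: (measurableT_comp (mcoord i)).
  apply: (measurableT_comp (measurable_mulmx M)).
  exact: measurable_snd.
apply: (measurableT_comp (mcoord i)); exact: measurable_fst.
Qed.

End MeanNorm.

Section MeanNormTheory.
Context {R : realType} {d : nat} (sigma : probability (borel R d) R).
Hypothesis hsigma : rotation_invariant_on_sphere sigma.
Local Notation S := (@sphere R d : set (borel R d)).
Local Notation mean_norm := (mean_norm sigma).
Implicit Types (u v w : 'cV[R]_d) (M N C Q : 'M[R]_d).

Lemma mean_normD M N : mean_norm (M + N) <= mean_norm M + mean_norm N.
Proof.
have mS := @measurable_sphere R d.
have iE := integrable_enorm_mulmx hsigma.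
rewrite -RintegralD //.
apply: le_Rintegral => //.
  exact: (integrableD mS (iE M) (iE N)).
by move=> u _; rewrite mulmxDl enormD.
Qed.

Lemma mean_normZ c M : mean_norm (c *: M) = `|c| * mean_norm M.
Proof.
rewrite -RintegralZl; last 2 first.
- exact: measurable_sphere.
- exact: (integrable_enorm_mulmx hsigma).
by apply: eq_Rintegral => u _; rewrite -scalemxAl enormZ.
Qed.

Lemma mean_norm_mull Q M : Q^T *m Q = 1%:M -> mean_norm (Q *m M) = mean_norm M.
Proof.
by move=> Qo; apply: eq_Rintegral => u _; rewrite -mulmxA enorm_orthogonal.
Qed.

(** Transposition turns this into [mean_norm_mull], so that every orthogonal
    matrix is covered although [sigma] is only known to be invariant under
    those of determinant 1. *)
Lemma mean_norm_mulr Q M : Q^T *m Q = 1%:M -> mean_norm (M *m Q) = mean_norm M.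
Proof.
move=> Qo; rewrite -(mean_norm_trmx hsigma) trmx_mul mean_norm_mull.
  exact: mean_norm_trmx.
by rewrite trmxK; apply: mulmx1C.
Qed.

Lemma enorm_gramD M N C u : N^T *m N = M^T *m M + C^T *m C ->
  enorm (N *m u) ^+ 2 = enorm (M *m u) ^+ 2 + enorm (C *m u) ^+ 2.
Proof. by move=> NMC; rewrite !sqr_enorm !dot_gram NMC mulmxDr mulmxDl mxE. Qed.

Lemma enorm_gram_le M N C u : N^T *m N = M^T *m M + C^T *m C ->
  enorm (M *m u) <= enorm (N *m u).
Proof.
move=> NMC; rewrite -(@ler_pXn2r _ 2) ?nnegrE ?enorm_ge0 //.
by rewrite (enorm_gramD u NMC) lerDl sqr_ge0.
Qed.

Lemma mean_norm_le M N C : N^T *m N = M^T *m M + C^T *m C ->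
  mean_norm M <= mean_norm N.
Proof.
move=> NMC; apply: le_Rintegral; try exact: (integrable_enorm_mulmx hsigma).
  exact: measurable_sphere.
by move=> u _; exact: enorm_gram_le NMC.
Qed.

(** If the integrals agree, then [C *m u] vanishes for almost all [u], hence so
    does its product with each row of [C]; as [mean_abs_dot] is a multiple of
    the norm, every row of [C] is 0. *)
Lemma mean_norm_lt M N C : N^T *m N = M^T *m M + C^T *m C -> C != 0 ->
  mean_norm M < mean_norm N.
Proof.
move=> NMC; apply: contraNT; rewrite -leNgt => NM.
have mS := @measurable_sphere R d.
have iM := integrable_enorm_mulmx hsigma M.
have iN := integrable_enorm_mulmx hsigma N.
pose g u := enorm (N *m u) - enorm (M *m u).
have g_ge0 u : 0 <= g u by rewrite subr_ge0 (enorm_gram_le _ NMC).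
have mg : measurable_fun S (EFin \o g).
  by apply/measurable_EFinP/measurable_funTS/measurable_funB;
    exact: measurable_enorm_mulmx.
have g0 : (\int[sigma]_(u in S) `|(g u)%:E| = 0)%E.
  under eq_integral do rewrite gee0_abs ?lee_fin //.
  apply/eqP; rewrite eq_le integral_ge0 ?andbT; last first.
    by move=> u _; rewrite lee_fin.
  rewrite -[leLHS]fineK; last first.
    by apply: integrable_fin_num => //; exact: (integrableB mS iN iM).
  by rewrite lee_fin -/(Rintegral _ _ _) RintegralB // subr_le0.
have /ae_eq_integral_abs := g0 => /(_ mS mg) aeg.
have rowC i : mean_abs_dot sigma (row i C)^T = 0.
  rewrite /mean_abs_dot /Rintegral.
  rewrite (ae_eq_integral (cst 0%E)) ?integral0 //.
    by have /integrableP[] := integrable_abs_dot hsigma (row i C)^T.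
  apply: filterS aeg => u gu Su; congr EFin.
  have {}gu : g u = 0 by apply: EFin_inj; exact: gu.
  have Cu : C *m u = 0.
    apply/eqP; rewrite -enorm_eq0 -sqrf_eq0.
    have := enorm_gramD u NMC.
    rewrite -[enorm (N *m u)](subrK (enorm (M *m u))).
    by rewrite -/(g u) gu add0r => /eqP; rewrite addrC -subr_eq subrr eq_sym.
  apply/eqP; rewrite normr_eq0; apply/eqP.
  transitivity ((C *m u) i 0); last by rewrite Cu mxE.
  by rewrite mxE; apply: eq_bigr => j _; rewrite !mxE.
have [k k_gt0 kE] := mean_abs_dot_propto hsigma.
apply/eqP/row_matrixP => i; rewrite row0; apply: trmx_inj; rewrite trmx0.
have /eqP := rowC i; rewrite kE mulf_eq0 (gt_eqF k_gt0) enorm_eq0.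
by move=> /eqP.
Qed.

End MeanNormTheory.

(** * Mean widths of ellipsoids *)

Section Ellipsoids.
Context {R : realType} {n : nat} (sigma : probability (borel R (n + n)) R).
Hypothesis hsigma : rotation_invariant_on_sphere sigma.
Implicit Types (a b : 'rV[R]_n) (P : 'M[R]_(n + n)).

Definition semiaxes a b : 'M[R]_(n + n) := diag_mx (row_mx a b).

Lemma ellipsoidE a b : (forall i, 0 < a 0 i) -> (forall i, 0 < b 0 i) ->
  ellipsoid a b = [set semiaxes a b *m w | w in [set w | dot w w <= 1]].
Proof.
move=> a_gt0 b_gt0.
have r_neq0 i : row_mx a b 0 i != 0.
  by rewrite mxE; case: (fintype.split i) => j; rewrite gt_eqF.
have dot_semiaxes w : dot w w = \sum_(i < n)
    ((usubmx (semiaxes a b *m w) i 0) ^+ 2 / (a 0 i) ^+ 2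
     + (dsubmx (semiaxes a b *m w) i 0) ^+ 2 / (b 0 i) ^+ 2).
  rewrite /dot big_split_ord /= -big_split /=; apply: eq_bigr => i _.
  rewrite mul_diag_mx !mxE !(unsplitK (inl _)) !(unsplitK (inr _)) !exprMn.
  by congr (_ + _); rewrite mulrAC divff ?expf_neq0 ?gt_eqF // mul1r expr2.
apply/seteqP; split=> [z Ez|_ [w w1 <-]]; last first.
  by rewrite /ellipsoid /= -dot_semiaxes.
have zE : z = semiaxes a b *m (\col_i (z i 0 / row_mx a b 0 i)).
  by apply/colP => i; rewrite mul_diag_mx mxE [X in _ * X]mxE mulrC divfK.
by rewrite zE; eexists; [|reflexivity]; rewrite /= dot_semiaxes -zE.
Qed.

Lemma support_function_ellipsoid a b P u :
  (forall i, 0 < a 0 i) -> (forall i, 0 < b 0 i) ->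
  support_function (mulmx P @` ellipsoid a b) u =
  enorm ((semiaxes a b *m P^T) *m u).
Proof.
move=> a_gt0 b_gt0; set M := _ *m P^T.
have dotP w : dot (P *m (semiaxes a b *m w)) u = dot w (M *m u).
  by rewrite !dot_mulmxl tr_diag_mx mulmxA.
rewrite /support_function ellipsoidE //; set X := [set _ | _ in _].
have Xub : ubound X (enorm (M *m u)).
  move=> _ [_ [_ [w w1 <-] <-] <-]; rewrite dotP.
  apply: le_trans (ler_norm _) _; apply: le_trans (ler_abs_dot _ _) _.
  by rewrite ler_piMl ?enorm_ge0 // -sqrtr1 ler_sqrt.
(* When [M *m u = 0], inverting 0 gives [w = 0], which is a maximiser too. *)
have Xmax : X (enorm (M *m u)).
  pose w := (enorm (M *m u))^-1 *: (M *m u).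
  exists (P *m (semiaxes a b *m w)).
    exists (semiaxes a b *m w) => //; exists w => //=.
    rewrite dotZl dotZr -sqr_enorm mulrA -expr2 -exprMn.
    have [->|e0] := eqVneq (enorm (M *m u)) 0; first by rewrite mulr0 expr0n.
    by rewrite mulVf // expr1n.
  rewrite dotP dotZl -sqr_enorm.
  have [->|e0] := eqVneq (enorm (M *m u)) 0; first by rewrite expr0n mulr0.
  by rewrite expr2 mulKf.
apply/eqP; rewrite eq_le; apply/andP; split.
  by apply: ge_sup => //; exists (enorm (M *m u)).
by apply: ub_le_sup => //; exists (enorm (M *m u)).
Qed.

Lemma mean_width_ellipsoid a b P :
  (forall i, 0 < a 0 i) -> (forall i, 0 < b 0 i) ->
  mean_width sigma (mulmx P @` ellipsoid a b) =
  2 * mean_norm sigma (semiaxes a b *m P^T).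
Proof.
move=> a_gt0 b_gt0; rewrite /mean_width -RintegralZl; last 2 first.
- exact: measurable_sphere.
- exact: (integrable_enorm_mulmx hsigma).
apply: eq_Rintegral => u _; rewrite !support_function_ellipsoid //.
by rewrite mulmxN -scaleN1r enormZ normrN1 mul1r mulr_natl mulr2n.
Qed.

End Ellipsoids.

(** * Symplectic images of ellipsoids with equal semi-axes *)

Section SymplecticMinimum.
Context {R : realType} {n : nat} (sigma : probability (borel R (n + n)) R).
Hypothesis hsigma : rotation_invariant_on_sphere sigma.
Local Notation mean_norm := (mean_norm sigma).
Local Notation J := (standard_J R n).
Implicit Types (a b : 'rV[R]_n) (P Q : 'M[R]_(n + n)).

Lemma trmx_standard_J : J^T = - J.
Proof.
rewrite /standard_J tr_block_mx opp_block_mx !trmx0 trmx1 linearN /= trmx1.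
by rewrite !oppr0 ?opprK.
Qed.

Lemma standard_J_sqr : J *m J = - 1%:M.
Proof.
rewrite /standard_J mulmx_block !mulmx0 !mul0mx mul1mx mulmx1.
by rewrite !addr0 !add0r (scalar_mx_block _ _ (1 : R)) opp_block_mx oppr0.
Qed.

Lemma standard_J_orthogonal : J^T *m J = 1%:M.
Proof. by rewrite trmx_standard_J mulNmx standard_J_sqr opprK. Qed.

Lemma semiaxes_block a b : semiaxes a b = block_mx (diag_mx a) 0 0 (diag_mx b).
Proof. exact: diag_mx_row. Qed.

Lemma semiaxes_comm_J a : semiaxes a a *m J = J *m semiaxes a a.
Proof.
rewrite semiaxes_block /standard_J !mulmx_block !mulmx0 !mul0mx !mulmx1 !mul1mx.
by rewrite mulmxN mulNmx mulmx1 mul1mx !addr0 !add0r.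
Qed.

Lemma tr_semiaxes a b : (semiaxes a b)^T = semiaxes a b.
Proof. exact: tr_diag_mx. Qed.

(** Twice the part of [Q] that anticommutes with the complex structure [J]. *)
Definition antilinear_part Q := Q + J *m Q *m J.

(** Twice the part of [Q] that commutes with the complex structure [J]. *)
Definition linear_part Q := Q - J *m Q *m J.

(** With [X := P^T] and [Y := J X J], the symplectic condition says that both
    cross terms [X Y^T] and [Y X^T] are [-1].  For the linear and antilinear
    parts themselves, the constant would be 1. *)
Lemma symplectic_gram P : @Sp R n P ->
  linear_part P^T *m (linear_part P^T)^T =
  antilinear_part P^T *m (antilinear_part P^T)^T + 4%:M.
Proof.
rewrite /Sp /= => PJP; rewrite /linear_part /antilinear_part.
set X := P^T; set Y := J *m X *m J.
have YT : Y^T = J *m X^T *m J.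
  by rewrite /Y !trmx_mul trmx_standard_J mulNmx !mulmxN opprK mulmxA.
have XJX : X *m J *m X^T = J by rewrite trmxK.
have XY : X *m Y^T = - 1%:M by rewrite YT !mulmxA XJX standard_J_sqr.
have YX : Y *m X^T = - 1%:M by rewrite -!mulmxA (mulmxA X) XJX standard_J_sqr.
have -> : (X - Y)^T = X^T - Y^T by rewrite linearB.
have -> : (X + Y)^T = X^T + Y^T by rewrite linearD.
rewrite !mulmxDl !mulmxDr !mulNmx !mulmxN XY YX !opprK.
move: (X *m X^T) (Y *m Y^T) => XX YY.
by apply/matrixP => i j; rewrite !mxE; case: (i == j); ring.
Qed.

Lemma antilinear_part_eq0 P : @Sp R n P ->
  antilinear_part P^T = 0 -> @Un R n P.
Proof.
move=> spP B0; split => //=; have := symplectic_gram spP.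
rewrite B0 mul0mx add0r.
have -> : linear_part P^T = 2 *: P^T.
  move: B0 => /eqP; rewrite addr_eq0 => /eqP B0.
  have JPJ : J *m P^T *m J = - P^T by rewrite [in RHS]B0 opprK.
  by rewrite /linear_part JPJ opprK scaler_nat mulr2n.
rewrite linearZ /= trmxK -scalemxAl -scalemxAr scalerA => PP.
apply: (@scalerI _ _ (2 * 2 : R)).
  by rewrite mulf_neq0 // pnatr_eq0.
by rewrite PP scale_scalar_mx mulr1 -natrM.
Qed.

(** As [D] commutes with [J], the matrix [D J Q J = J (D Q) J] has the same
    mean norm as [D Q]. *)
Lemma mean_norm_linear_part a Q :
  mean_norm (semiaxes a a *m linear_part Q) <=
    2 * mean_norm (semiaxes a a *m Q).
Proof.
rewrite /linear_part mulmxBr mulr_natl mulr2n.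
apply: (le_trans (mean_normD hsigma _ _)); rewrite lerD2l.
rewrite -scaleN1r mean_normZ // normrN1 mul1r !mulmxA semiaxes_comm_J.
rewrite (mean_norm_mulr hsigma _ standard_J_orthogonal) -mulmxA.
by rewrite (mean_norm_mull sigma _ standard_J_orthogonal).
Qed.

Lemma semiaxes_gram a P : @Sp R n P -> let A := linear_part P^T in
  let B := antilinear_part P^T in
  (A^T *m semiaxes a a)^T *m (A^T *m semiaxes a a) =
  (2 *: semiaxes a a)^T *m (2 *: semiaxes a a) +
  (B^T *m semiaxes a a)^T *m (B^T *m semiaxes a a).
Proof.
move=> spP A B; have -> : (2 *: semiaxes a a)^T = 2 *: semiaxes a a.
  by rewrite linearZ /= tr_semiaxes.
rewrite !trmx_mul !trmxK tr_semiaxes !mulmxA -(mulmxA _ A) -(mulmxA _ B).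
rewrite (symplectic_gram spP) mulmxDr mulmxDl addrC; congr (_ + _).
by rewrite -scalemxAl -scalemxAr scalerA mul_mx_scalar -scalemxAl -natrM.
Qed.

Lemma linear_part_le a P :
  mean_norm ((linear_part P^T)^T *m semiaxes a a) <=
    2 * mean_norm (semiaxes a a *m P^T).
Proof.
rewrite -(mean_norm_trmx hsigma) trmx_mul trmxK tr_semiaxes.
exact: mean_norm_linear_part.
Qed.

Lemma semiaxes_min a P : @Sp R n P ->
  mean_norm (semiaxes a a) <= mean_norm (semiaxes a a *m P^T).
Proof.
move=> spP; rewrite -(ler_pM2l (ltr0Sn R 1)).
apply: le_trans (linear_part_le a P).
have := mean_norm_le hsigma (semiaxes_gram a spP).
by rewrite mean_normZ // ger0_norm.
Qed.

Lemma semiaxes_min_strict a P :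
  (forall i, 0 < a 0 i) -> @Sp R n P -> ~ @Un R n P ->
  mean_norm (semiaxes a a) < mean_norm (semiaxes a a *m P^T).
Proof.
move=> a_gt0 spP nU; rewrite -(ltr_pM2l (ltr0Sn R 1)).
apply: lt_le_trans (linear_part_le a P).
have := mean_norm_lt hsigma (semiaxes_gram a spP).
rewrite mean_normZ // ger0_norm //; apply.
apply/eqP => BD0; apply: nU; apply: antilinear_part_eq0 => //.
set B := antilinear_part _ in BD0 *.
apply: trmx_inj; rewrite trmx0; apply/matrixP => i j.
move/matrixP/(_ i j): BD0; rewrite mul_mx_diag !mxE => /eqP.
rewrite mulf_eq0 => /orP[/eqP //|].
by case: (fintype.split j) => k; rewrite gt_eqF.
Qed.

End SymplecticMinimum.

(** * Squeezing a pair of unequal semi-axes *)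

Section Squeezing.
Context {R : realType} {d : nat} (sigma : probability (borel R d) R).
Hypothesis hsigma : rotation_invariant_on_sphere sigma.
Local Notation mean_norm := (mean_norm sigma).
Implicit Types (r t : 'rV[R]_d) (p q : 'I_d).

Lemma mean_norm_diag_perm (s : {perm 'I_d}) r :
  mean_norm (diag_mx (col_perm s r)) = mean_norm (diag_mx r).
Proof.
have perm_orth (z : {perm 'I_d}) : (perm_mx z : 'M[R]_d)^T *m perm_mx z = 1%:M.
  by rewrite tr_perm_mx -perm_mxM mulVg perm_mx1.
have -> : diag_mx (col_perm s r) = perm_mx s *m diag_mx r *m perm_mx s^-1%g.
  rewrite -row_permE -col_permE; apply/matrixP => i j.
  by rewrite !mxE (inj_eq perm_inj).
by rewrite mean_norm_mulr // mean_norm_mull.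
Qed.

Lemma mean_norm_diag_lt r t p : (forall j, 0 <= r 0 j <= t 0 j) ->
  r 0 p < t 0 p -> mean_norm (diag_mx r) < mean_norm (diag_mx t).
Proof.
move=> rt rtp.
pose c : 'rV[R]_d := \row_j Num.sqrt (t 0 j ^+ 2 - r 0 j ^+ 2).
have rt2 j : r 0 j ^+ 2 <= t 0 j ^+ 2.
  have /andP[r0 rtj] := rt j; rewrite ler_pXn2r ?nnegrE //.
  exact: le_trans rtj.
apply: (mean_norm_lt hsigma (C := diag_mx c)).
  rewrite !tr_diag_mx !mulmx_diag -linearD; congr diag_mx.
  by apply/rowP => j; rewrite !mxE -!expr2 sqr_sqrtr ?subr_ge0 // addrC subrK.
apply/eqP => /matrixP /(_ p p); rewrite !mxE eqxx mulr1n => /eqP.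
apply/negP; rewrite gt_eqF // sqrtr_gt0 subr_gt0.
have /andP[r0 rtj] := rt p.
by rewrite ltr_pXn2r ?nnegrE // (le_trans r0).
Qed.

Definition squeeze p q (s : R) : 'rV[R]_d :=
  \row_j (if j == p then s else if j == q then s^-1 else 1).

(** The squeezed semi-axes are dominated by a convex combination of the
    original ones and of those with [p] and [q] exchanged. *)
Lemma mean_norm_squeeze r p q (s : R) : p != q -> (forall j, 0 < r 0 j) ->
  0 < s < 1 -> r 0 q < s * r 0 p ->
  mean_norm (diag_mx r *m diag_mx (squeeze p q s)) < mean_norm (diag_mx r).
Proof.
move=> pq r_gt0 /andP[s0 s1] rqp.
have qp : (q == p) = false by rewrite eq_sym (negPf pq).
set al := r 0 p in rqp *; set be := r 0 q in rqp *.
have be0 : 0 < be by exact: r_gt0.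
have al0 : 0 < al by exact: r_gt0.
have beal : be < al.
  by apply: lt_trans rqp _; rewrite gtr_pMl.
(* The weight for which the [q]-th semi-axis of the combination is [be / s]. *)
pose t := (be / s - be) / (al - be).
have tE : t * (al - be) = be / s - be by rewrite divfK // subr_eq0 gt_eqF.
have s_ge1 : 1 < s^-1 by rewrite invf_gt1.
have bes : be / s < al by rewrite ltr_pdivrMr // mulrC.
have t0 : 0 <= t.
  by rewrite divr_ge0 ?subr_ge0 ?(ltW beal) // ler_peMr ?ltW.
have t1 : t <= 1.
  by rewrite ler_pdivrMr ?subr_gt0 // mul1r lerD2r ltW.
pose r' := (1 - t) *: r + t *: col_perm (tperm p q) r.
have r'E j : r' 0 j = if j == p then al + be - be / s
    else if j == q then be / s else r 0 j.
  rewrite !mxE; case: eqP => [->|/eqP jp]; last case: eqP => [->|/eqP jq].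
  - rewrite tpermL -/al -/be; lra.
  - rewrite tpermR -/al -/be; lra.
  - by rewrite tpermD 1?eq_sym //; ring.
apply: (@lt_le_trans _ _ (mean_norm (diag_mx r'))); last first.
  have diagZ c x : diag_mx (c *: x) = c *: diag_mx x :> 'M[R]_d.
    by rewrite linearZ.
  rewrite linearD /= !diagZ; apply: le_trans (mean_normD hsigma _ _) _.
  rewrite !mean_normZ // mean_norm_diag_perm !ger0_norm ?subr_ge0 //.
  by rewrite -mulrDl subrK mul1r.
(* This is [(al * s - be) * (s^-1 - 1) > 0]. *)
have alE : al * s < al + be - be / s.
  have : 0 < (al * s - be) * (s^-1 - 1) by rewrite mulr_gt0 ?subr_gt0 // mulrC.
  by rewrite mulrBr mulr1 mulrBl -mulrA mulfV ?gt_eqF // mulr1; lra.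
rewrite mulmx_diag; apply: (mean_norm_diag_lt (p := p)) => [j|].
  rewrite r'E !mxE; case: eqP => [->|/eqP jp]; last case: eqP => [->|/eqP jq].
  - by rewrite -/al (ltW alE) mulr_ge0 ?ltW.
  - by rewrite -/be lexx mulr_ge0 ?invr_ge0 ?ltW.
  - by rewrite mulr1 lexx ltW.
by rewrite r'E !mxE !eqxx.
Qed.

End Squeezing.

Section SqueezeMatrices.
Context {R : realType} {n : nat}.

Definition squeeze_mx (i : 'I_n) (c : R) : 'M[R]_(n + n) :=
  diag_mx (squeeze (lshift n i) (rshift n i) c).

Lemma squeeze_mx_symplectic i (c : R) : c != 0 -> @Sp R n (squeeze_mx i c).
Proof.
move=> c0; pose x : 'rV[R]_n := \row_j (if j == i then c else 1).
pose y : 'rV[R]_n := \row_j (if j == i then c^-1 else 1).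
have -> : squeeze_mx i c = semiaxes x y.
  congr diag_mx; apply/rowP => k; rewrite !mxE.
  case: splitP => j kj.
    have -> : k = lshift n j by exact: val_inj.
    by rewrite (inj_eq (@lshift_inj _ _)) eq_lrshift !mxE.
  have -> : k = rshift n j by exact: val_inj.
  by rewrite eq_rlshift (inj_eq (@rshift_inj _ _)) !mxE.
have xy : diag_mx x *m diag_mx y = 1%:M.
  rewrite mulmx_diag -diag_const_mx; congr diag_mx; apply/rowP => j.
  by rewrite !mxE; case: eqP => _; rewrite ?mulfV ?mulr1.
rewrite /Sp /= tr_semiaxes semiaxes_block /standard_J !mulmx_block.
rewrite !mulmx0 !mul0mx !addr0 !add0r !mulmx1 !mul0mx !mulmxN !mulmx1 !mulNmx.
by rewrite xy (mulmx1C xy).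
Qed.

Lemma squeeze_mx_near1 i c (e : R) : 0 < e ->
  `|1 - c| < e -> `|1 - c^-1| < e ->
  ball (1%:M : 'M[R]_(n + n)) e (squeeze_mx i c).
Proof.
move=> e0 ce ce'; split=> // j k; rewrite /ball /= !mxE.
have [->|jk] := eqVneq j k; last by rewrite !mulr0n subrr normr0.
by rewrite !mulr1n; do 2?case: ifP => _ //; rewrite subrr normr0.
Qed.

Lemma squeezeV d (p q : 'I_d) (s : R) :
  p != q -> squeeze q p s^-1 = squeeze p q s.
Proof.
move=> pq; apply/rowP => j; rewrite !mxE invrK.
by case: eqP => // ->; rewrite eq_sym (negPf pq).
Qed.

End SqueezeMatrices.

(** * Local minima of the mean width *)

Section LocalMinima.
Context {R : realType} {n : nat} (sigma : probability (borel R (n + n)) R).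
Hypothesis hsigma : rotation_invariant_on_sphere sigma.
Implicit Types (a b : 'rV[R]_n).

Lemma squeeze_mx_decreases a b i (e : R) :
  (forall i, 0 < a 0 i) -> (forall i, 0 < b 0 i) -> a 0 i != b 0 i -> 0 < e ->
  exists c : R, [/\ c != 0, `|1 - c| < e, `|1 - c^-1| < e &
    mean_norm sigma (semiaxes a b *m squeeze_mx i c) <
    mean_norm sigma (semiaxes a b)].
Proof.
move=> a0 b0 ab e0.
pose r := row_mx a b.
have r_gt0 j : 0 < r 0 j by rewrite mxE; case: (fintype.split j).
have step (p q : 'I_(n + n)) : p != q -> r 0 q < r 0 p -> exists s : R,
    [/\ s != 0, `|1 - s| < e, `|1 - s^-1| < e &
    mean_norm sigma (diag_mx r *m diag_mx (squeeze p q s)) <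
    mean_norm sigma (diag_mx r)].
  move=> pq rqp.
  (* With [s := (1 + h)^-1] one has [s^-1 - 1 = h] and [1 - s <= h], and the
     second bound on [h] ensures that [r 0 q < s * r 0 p]. *)
  pose h := Num.min (e / 2) ((r 0 p / r 0 q - 1) / 2).
  have rr : 1 < r 0 p / r 0 q by rewrite ltr_pdivlMr // mul1r.
  have h0 : 0 < h by rewrite lt_min !divr_gt0 // subr_gt0.
  have he : h < e.
    by apply: (@le_lt_trans _ _ (e / 2)); [rewrite ge_min lexx|lra].
  have hr : 1 + h < r 0 p / r 0 q.
    have : h <= (r 0 p / r 0 q - 1) / 2 by rewrite ge_min lexx orbT.
    lra.
  have h1 : 0 < 1 + h by lra.
  exists (1 + h)^-1; rewrite invr_eq0 gt_eqF // invrK; split => //.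
  - rewrite (_ : 1 - (1 + h)^-1 = h / (1 + h)); last by field; rewrite gt_eqF.
    rewrite ger0_norm ?divr_ge0 ?ltW //; apply: le_lt_trans he.
    by rewrite ler_pdivrMr // ler_peMr ?ltW //; lra.
  - by rewrite opprD addrA subrr add0r normrN gtr0_norm.
  - apply: mean_norm_squeeze => //.
      by rewrite invr_gt0 h1 invf_lt1 //; lra.
    by rewrite mulrC ltr_pdivlMr // mulrC -ltr_pdivlMr.
have rl : r 0 (lshift n i) = a 0 i by rewrite row_mxEl.
have rr : r 0 (rshift n i) = b 0 i by rewrite row_mxEr.
move: ab; rewrite neq_lt => /orP[ab|ba].
  have [||s [s0 s1 s2 lt]] := step (rshift n i) (lshift n i).
  - by rewrite eq_rlshift.
  - by rewrite rl rr.
  exists s^-1; rewrite invr_eq0 invrK.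
  apply: And4; [exact: s0|exact: s2|exact: s1|].
  by rewrite /squeeze_mx squeezeV // eq_rlshift.
by apply: step; rewrite ?eq_lrshift ?rl ?rr.
Qed.

Lemma local_min_semiaxes_eq a b :
  (forall i, 0 < a 0 i) -> (forall i, 0 < b 0 i) ->
  local_min_on (@Sp R n)
    (fun P : 'M[R]_(n + n) => mean_width sigma (mulmx P @` ellipsoid a b))
    1%:M ->
  a = b.
Proof.
move=> a0 b0 /nbhs_ballP[e /= e0 min1]; apply/rowP => i; apply/eqP.
apply/negPn/negP => ab.
have [c [c0 c1 c2]] := squeeze_mx_decreases a0 b0 ab e0.
apply/negP; rewrite -leNgt.
have := min1 _ (squeeze_mx_near1 i e0 c1 c2) (squeeze_mx_symplectic i c0).
have widthE P := mean_width_ellipsoid hsigma P a0 b0.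
rewrite [X in X <= _]widthE [X in _ <= X]widthE trmx1 mulmx1 tr_diag_mx.
by rewrite ler_pM2l ?ltr0Sn.
Qed.

Lemma mean_width_min a P : (forall i, 0 < a 0 i) -> @Sp R n P ->
  mean_width sigma (mulmx 1%:M @` ellipsoid a a) <=
  mean_width sigma (mulmx P @` ellipsoid a a).
Proof.
move=> a0 spP; rewrite !(mean_width_ellipsoid hsigma _ a0 a0) trmx1 mulmx1.
rewrite ler_pM2l ?ltr0Sn //.
exact: semiaxes_min.
Qed.

Lemma mean_width_min_strict a P :
  (forall i, 0 < a 0 i) -> @Sp R n P -> ~ @Un R n P ->
  mean_width sigma (mulmx 1%:M @` ellipsoid a a) <
  mean_width sigma (mulmx P @` ellipsoid a a).
Proof.
move=> a0 spP nU; rewrite !(mean_width_ellipsoid hsigma _ a0 a0) trmx1 mulmx1.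
rewrite ltr_pM2l ?ltr0Sn //.
exact: semiaxes_min_strict.
Qed.

End LocalMinima.

Theorem proposition1p11 (R : realType) (n : nat)
    (sigma : probability (borel R (n + n)) R)
    (hsigma : rotation_invariant_on_sphere sigma) :
  (forall a b : 'rV[R]_n,
     (forall i, 0 < a 0 i) -> (forall i, 0 < b 0 i) ->
     local_min_on (@Sp R n)
       (fun P : 'M[R]_(n + n) => mean_width sigma (mulmx P @` ellipsoid a b))
       1%:M
     <-> a = b) /\
  (forall a : 'rV[R]_n,
     (forall i, 0 < a 0 i) ->
     isolated_local_min_on (@Sp R n) (@same_Un_orbit R n)
       (fun P : 'M[R]_(n + n) => mean_width sigma (mulmx P @` ellipsoid a a))
       1%:M).
Proof.
have min_eq (a : 'rV[R]_n) : (forall i, 0 < a 0 i) -> local_min_on (@Sp R n)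
    (fun P : 'M[R]_(n + n) => mean_width sigma (mulmx P @` ellipsoid a a)) 1%:M.
  by move=> a0; rewrite /local_min_on near_withinE; apply: nearW => P spP;
    exact: (mean_width_min hsigma a0 spP).
split=> [a b a0 b0|a a0].
  split; first exact: (local_min_semiaxes_eq hsigma).
  by move=> <-; exact: min_eq.
split; first exact: min_eq.
rewrite near_withinE; apply: nearW => P spP nr.
apply: (mean_width_min_strict hsigma a0 spP) => UP.
by apply: nr; exists P => //; rewrite mulmx1.
Qed.
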